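(* Let $G$ be a finite connected graph with embedding scheme $\Pi=(\pi,\lambda)$, and let $\mathcal{C}=\mathcal{C}_1\cup\mathcal{C}_2$ be as defined in the context (for an arbitrary choice of breadth-first-search trees $T_x$, $x\in V(G)$). Then: (a) if $G$ contains a $\Pi$-twosided cycle, then $\mathcal{C}$ contains a $\Pi$-twosided cycle of minimum length among all $\Pi$-twosided cycles of $G$; (b) every even cycle of $G$ whose length is minimum among all even cycles of $G$ belongs to $\mathcal{C}$; (c) if a shortest cycle of $G$ (i.e. a cycle of length equal to the girth of $G$) has odd length, then every odd cycle of $G$ whose length is minimum among all odd cycles of $G$ belongs to $\mathcal{C}_1$.
   Context: Graphs are finite and connected; cycles are identified with their edge sets and the length $|C|$ of a cycle is its number of edges. An embedding scheme of $G$ is $\Pi=(\pi,\lambda)$ where $\pi=\{\pi_v: v\in V(G)\}$ is a rotation system ($\pi_v$ a cyclic ordering of the edges incident with $v$) and $\lambda:E(G)\to\{-1,+1\}$ is a signature. A cycle is $\Pi$-twosided if it contains an even number of edges $e$ with $\lambda(e)=-1$, and $\Pi$-onesided otherwise. For each vertex $x$, $T_x$ denotes a breadth-first-search spanning tree of $G$ rooted at $x$ (so the path in $T_x$ from $x$ to any vertex is a shortest path in $G$). A fundamental cycle of a spanning tree $T$ is the unique cycle in $T+e$ for an edge $e\notin E(T)$. $\mathcal{C}_1$ is the set of all fundamental cycles of the trees $T_x$, $x\in V(G)$; $\mathcal{C}_2$ is the set of all cycles $C$ of $G$ such that $C=C_a\oplus C_b$ for some $C_a,C_b\in\mathcal{C}_1$,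 where $A\oplus B=(A\setminus B)\cup(B\setminus A)$ for edge sets $A,B$; and $\mathcal{C}=\mathcal{C}_1\cup\mathcal{C}_2$. *)

(* Defs.v *)
From mathcomp Require Import all_boot.
Set Implicit Arguments. Unset Strict Implicit. Unset Printing Implicit Defensive.

Section Graph.
Variables (V E : finType) (ends : E -> V * V).

Definition joins (e : E) (u v : V) : bool :=
  (ends e == (u, v)) || (ends e == (v, u)).

Fixpoint is_walk (F : {set E}) (u : V) (es : seq E) (v : V) : Prop :=
  match es with
  | [::] => u = v
  | e :: es' => e \in F /\ exists w, joins e u w /\ is_walk F w es' v
  end.

Definition connected_graph : Prop :=
  forall u v : V, exists es, is_walk [set: E] u es v.

(* C (an edge set) is a cycle: there are distinct vertices v_0..v_k and
   distinct edges e_0..e_k with e_i joining v_i and v_{i+1 mod (k+1)},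
   and C = {e_0,..,e_k}.  Its length is #|C|. *)
Definition is_cycle (C : {set E}) : Prop :=
  exists (v0 : V) (vs : seq V) (e0 : E) (es : seq E),
    [/\ size vs = size es, uniq (v0 :: vs), uniq (e0 :: es),
        (forall i, i <= size es ->
           joins (nth e0 (e0 :: es) i) (nth v0 (v0 :: vs) i) (nth v0 (rcons vs v0) i))
      & C = [set e in e0 :: es]].

Definition spanning_tree (T : {set E}) : Prop :=
  (forall u v : V, exists es, is_walk T u es v) /\
  (forall C, is_cycle C -> ~ (C \subset T)).

Definition bfs_tree (T : {set E}) (x : V) : Prop :=
  spanning_tree T /\
  forall v, exists es, is_walk T x es v /\
     forall es', is_walk [set: E] x es' v -> size es <= size es'.

Definition fund_cycle (T : {set E}) (e : E) (C : {set E}) : Prop :=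
  e \notin T /\ is_cycle C /\ C \subset e |: T.

Variable Tf : V -> {set E}.  (* the chosen BFS trees T_x *)

Definition in_C1 (C : {set E}) : Prop :=
  exists x e, fund_cycle (Tf x) e C.

Definition symdiff (A B : {set E}) : {set E} := (A :\: B) :|: (B :\: A).

Definition in_C2 (C : {set E}) : Prop :=
  is_cycle C /\ exists Ca Cb, in_C1 Ca /\ in_C1 Cb /\ C = symdiff Ca Cb.

Definition in_C (C : {set E}) : Prop := in_C1 C \/ in_C2 C.

End Graph.

(* signature: lam e = true means lambda(e) = -1 *)
Definition twosided (E : finType) (lam : E -> bool) (C : {set E}) : bool :=
  ~~ odd #|[set e in C | lam e]|.

(* Main.v *)
(** Over the field with two elements, cycles are the minimal nonempty even edge
    sets.  Call a cycle isometric if no path is shorter than both arcs of the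
    cycle between its ends.  A cycle that is not isometric is the sum of two
    shorter cycles, so if it is a shortest twosided cycle, then both of these are
    onesided, and each is isometric, for otherwise it would split in turn into a
    onesided and a twosided cycle, both too short.

    Let [D] be isometric of length [n], let [x] be a vertex of [D], and let [e] be
    an edge of [D] outside [T_x] that is incident with (or, for [n] odd, opposite
    at) the antipode of [x].  If [e] is the only edge of [D] outside [T_x], then [D]
    is a fundamental cycle.  Otherwise let [f] be the next edge of [D] outside
    [T_x].  Since depths in [T_x] agree with distances along [D], the fundamental
    cycles of [e], of [f] and their sum all have length at most [n]; they share the
    edge from the end of [f] farther from [x] to its parent, so the sum is a cycle,
    and one of the three is twosided.  Hence a onesided cycle [D] shorter than every
    twosided cycle is in [C_1], and a shortest twosided cycle is itself in [C] or
    may be replaced by one in [C]. *)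

Require Import Defs.
From mathcomp Require Import all_boot zify.
Set Implicit Arguments. Unset Strict Implicit. Unset Printing Implicit Defensive.

Local Notation "A :+: B" := (symdiff A B) (at level 52, left associativity).

(** * Symmetric difference as addition over the two-element field *)

Section SymDiff.
Variable E : finType.
Implicit Types (A B C : {set E}).

Lemma in_symdiff A B x : (x \in A :+: B) = (x \in A) (+) (x \in B).
Proof. by rewrite !inE; case: (x \in A); case: (x \in B). Qed.

Lemma symdiffC A B : A :+: B = B :+: A.
Proof. by apply/setP=> z; rewrite !in_symdiff addbC. Qed.

Lemma symdiffA A B C : A :+: (B :+: C) = A :+: B :+: C.
Proof. by apply/setP=> z; rewrite !in_symdiff addbA. Qed.

Lemma symdiffAA A : A :+: A = set0.
Proof. by apply/setP=> z; rewrite in_symdiff addbb inE. Qed.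

Lemma symdiff0 A : A :+: set0 = A.
Proof. by apply/setP=> z; rewrite in_symdiff inE addbF. Qed.

Lemma symdiffK A B : A :+: B :+: B = A.
Proof. by rewrite -symdiffA symdiffAA symdiff0. Qed.

Lemma symdiff_eq0 A B : A :+: B = set0 -> A = B.
Proof. by move=> AB0; rewrite -(symdiffK A B) AB0 symdiffC symdiff0. Qed.

Lemma symdiff_sub A B C : A \subset C -> B \subset C -> A :+: B \subset C.
Proof.
move=> /subsetP AC /subsetP BC; apply/subsetP=> z; rewrite in_symdiff.
by case zA: (z \in A); case zB: (z \in B) => //= _; [apply: AC | apply: BC].
Qed.

Lemma symdiff_subset A B : B \subset A -> A :+: B = A :\: B.
Proof.
move=> /subsetP BA; apply/setP=> z; rewrite in_symdiff inE.
by case zB: (z \in B); rewrite ?addbF // BA.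
Qed.

Lemma symdiff_set1 A x : x \notin A -> A :+: [set x] = x |: A.
Proof.
move=> xA; apply/setP=> z; rewrite in_symdiff !inE.
by case: eqP => [->|]; rewrite ?(negbTE xA) ?addbF.
Qed.

Lemma card_symdiff A B : #|A :+: B| + #|A :&: B| * 2 = #|A| + #|B|.
Proof.
have dAB : (A :\: B) :&: (B :\: A) = set0.
  by apply/setP=> z; rewrite !inE; case: (z \in A); case: (z \in B).
rewrite -(cardsID B A) -(cardsID A B) [B :&: A]setIC.
rewrite /symdiff cardsU dAB cards0; lia.
Qed.

Lemma leq_card_symdiff A B : #|A :+: B| <= #|A| + #|B|.
Proof. by have := card_symdiff A B; lia. Qed.

Lemma odd_card_symdiff A B : odd #|A :+: B| = odd #|A| (+) odd #|B|.
Proof. by rewrite -oddD -card_symdiff oddD oddM andbF addbF. Qed.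

Lemma twosided_symdiff lam A B :
  twosided lam (A :+: B) = ~~ (twosided lam A (+) twosided lam B).
Proof.
have -> : twosided lam (A :+: B) =
    ~~ odd #|[set e in A | lam e] :+: [set e in B | lam e]|.
  rewrite /twosided; congr (~~ odd #|pred_of_set _|); apply/setP=> z.
  by rewrite inE !in_symdiff !inE; case: (lam z); rewrite ?andbT ?andbF.
by rewrite odd_card_symdiff /twosided; do 2!case: odd.
Qed.

End SymDiff.

(** * Boundaries, even edge sets and paths modulo 2 *)

Section Boundary.
Variables (V E : finType) (ends : E -> V * V).
Implicit Types (F A B C Z : {set E}) (u v w : V).

Definition incident e v := ((ends e).1 == v) (+) ((ends e).2 == v).

(* The mod 2 degree of [v] in [F]; a loop contributes 0. *)
Definition boundary F v := \big[addb/false]_e ((e \in F) && incident e v).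

Definition even_set F := forall v, boundary F v = false.

(** Stands in for a path from [u] to [v]. Such sets compose under [:+:] with no care for repeated
    vertices or edges, and contain an actual path by [links_steps]. *)
Definition links F u v := forall w, boundary F w = (u == w) (+) (v == w).

(** Equivalent to [is_cycle] by [circuitP]; that a sum of edge sets is a single cycle thus becomes a
    question about even subsets. *)
Definition circuit C :=
  [/\ C != set0, even_set C &
      forall Z, Z \subset C -> Z != set0 -> even_set Z -> Z = C].

Lemma boundary_symdiff A B v :
  boundary (A :+: B) v = boundary A v (+) boundary B v.
Proof.
rewrite /boundary -big_split; apply: eq_bigr => e _.
by rewrite in_symdiff andb_addl.
Qed.

Lemma even_symdiff A B : even_set A -> even_set B -> even_set (A :+: B).
Proof. by move=> eA eB v; rewrite boundary_symdiff eA eB. Qed.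

Lemma boundary0 v : boundary set0 v = false.
Proof. by apply: big1 => e _; rewrite inE. Qed.

Lemma boundary1 e v : boundary [set e] v = incident e v.
Proof.
rewrite /boundary (bigD1 e) //= inE eqxx /= big1 ?addbF // => f /negbTE fe.
by rewrite inE fe.
Qed.

Lemma joins_incident e u v w :
  joins ends e u v -> incident e w = (u == w) (+) (v == w).
Proof. by rewrite /incident => /orP[] /eqP-> //=; rewrite addbC. Qed.

Lemma joinsC e u v : joins ends e u v = joins ends e v u.
Proof. by rewrite /joins orbC. Qed.

Lemma joins_ends e : joins ends e (ends e).1 (ends e).2.
Proof. by rewrite /joins -surjective_pairing eqxx. Qed.

Lemma joins_inj e a b c d : joins ends e a b -> joins ends e c d ->
  (a = c /\ b = d) \/ (a = d /\ b = c).
Proof.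
by rewrite /joins; case/orP=> /eqP->; case/orP=> /eqP[-> ->]; [left|right|right|left].
Qed.

Lemma joins_links e u v : joins ends e u v -> links [set e] u v.
Proof. by move=> j w; rewrite boundary1 (joins_incident _ j). Qed.

Lemma links_sym F u v : links F u v -> links F v u.
Proof. by move=> h w; rewrite h addbC. Qed.

Lemma links_trans A B u v w : links A u v -> links B v w -> links (A :+: B) u w.
Proof.
move=> hA hB z; rewrite boundary_symdiff hA hB.
by case: (u == z); case: (v == z); case: (w == z).
Qed.

(** Edges traversed an even number of times cancel, hence a mere inequality for the size. *)
Lemma walk_links F u es v : is_walk ends F u es v ->
  exists P : {set E}, [/\ P \subset F, {subset P <= es}, #|P| <= size es & links P u v].
Proof.
elim: es u => [|e es IH] u /=.
  move=> ->; exists set0; split; rewrite ?sub0set ?cards0 //.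
    by move=> z; rewrite inE.
  by move=> w; rewrite boundary0 addbb.
case=> eF [w [j /IH[P [PF Pes sP lP]]]]; exists ([set e] :+: P); split.
- by apply: symdiff_sub; rewrite ?sub1set.
- by move=> z; rewrite in_symdiff !inE; case: eqP => //= _ /Pes.
- by apply: leq_trans (leq_card_symdiff _ _) _; rewrite cards1.
- exact: links_trans (joins_links j) lP.
Qed.

Definition linked F : rel V := fun u v => [exists e in F, joins ends e u v].

(* Every edge has both or neither of its ends in the component of [u], so the
   boundary of [F] sums to zero over that component. *)
Lemma links_connect F u v : links F u v -> connect (linked F) u v.
Proof.
move=> lF; apply/idPn=> nuv.
pose S := [pred w | connect (linked F) u w].
have sum1 x : \big[addb/false]_(w | S w) (x == w) = S x.
  case Sx: (S x).
    rewrite (bigD1 x) //= eqxx big1 // => w /andP[_ /negbTE wx].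
    by rewrite eq_sym.
  by rewrite big1 // => w Sw; apply: contraFF Sx => /eqP->.
have sumF : \big[addb/false]_(w | S w) boundary F w = false.
  rewrite /boundary exchange_big /= big1 // => e _.
  case eF: (e \in F) => /=; last by rewrite big1.
  rewrite /incident big_split /= !sum1.
  have l12 : linked F (ends e).1 (ends e).2.
    by apply/existsP; exists e; rewrite eF joins_ends.
  have l21 : linked F (ends e).2 (ends e).1.
    by apply/existsP; exists e; rewrite eF joinsC joins_ends.
  suff -> : S (ends e).1 = S (ends e).2 by rewrite addbb.
  apply/idP/idP => h.
    exact: connect_trans h (connect1 l12).
  exact: connect_trans h (connect1 l21).
move: sumF; under eq_bigr => w _ do rewrite lF.
by rewrite big_split /= !sum1 /= connect0 (negbTE nuv).
Qed.

Fixpoint steps u (vs : seq V) (es : seq E) : bool :=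
  match vs, es with
  | w :: vs', e :: es' => joins ends e u w && steps w vs' es'
  | [::], [::] => true
  | _, _ => false
  end.

Lemma steps_size u vs es : steps u vs es -> size vs = size es.
Proof. by elim: vs es u => [|w vs IH] [|e es] u //= /andP[_ /IH->]. Qed.

Lemma steps_nth u vs es x e0 i : steps u vs es -> i < size es ->
  joins ends (nth e0 es i) (nth x (u :: vs) i) (nth x vs i).
Proof.
elim: vs es u i => [|w vs IH] [|e es] u [|i] //= /andP[j h] // lti.
exact: IH h lti.
Qed.

Lemma steps_walk F u vs es : steps u vs es -> {subset es <= F} ->
  is_walk ends F u es (last u vs).
Proof.
elim: vs es u => [|w vs IH] [|e es] u //= /andP[j h] sF; split.
  by apply: sF; rewrite mem_head.
exists w; split=> //; apply: IH => // f fes; apply: sF.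
by rewrite inE fes orbT.
Qed.

Lemma links_steps F u v : links F u v -> exists vs es,
  [/\ steps u vs es, last u vs = v, uniq (u :: vs), uniq es & {subset es <= F}].
Proof.
move=> /links_connect/connectP[p pp ->].
case: (shortenP pp) => {pp}q pq uq _; exists q.
suff [es [h ues sF sq]] : exists es, [/\ steps u q es, uniq es, {subset es <= F}
    & forall e a b, e \in es -> joins ends e a b -> a \in u :: q].
  by exists es; split.
elim: q u pq uq => [|w q IH] u; first by exists [::]; split.
move=> /= /andP[/existsP[e /andP[eF j]] pq] /andP[uwq uq].
have [es [h ues sF sq]] := IH w pq uq.
exists (e :: es); split=> /=; rewrite ?j ?h ?ues //.
(* If [e] recurred later, its end [u] would be among the later vertices. *)
- rewrite andbT; apply/negP=> /sq/(_ j) uq'; by rewrite uq' in uwq.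
- by move=> f; rewrite inE => /orP[/eqP->|/sF].
- move=> f a b; rewrite inE => /orP[/eqP-> /(joins_inj j)|/sq h' /h' aq].
    by move=> [[<- _]|[_ <-]]; rewrite !inE eqxx ?orbT.
  by rewrite inE aq orbT.
Qed.

Lemma links_walk F u v : links F u v ->
  exists es, is_walk ends [set: E] u es v /\ size es <= #|F|.
Proof.
move=> /links_steps[vs [es [h <- _ ues sF]]]; exists es; split.
  by apply: steps_walk h _ => e; rewrite inE.
by rewrite cardE; apply: uniq_leq_size ues _ => e /sF eF; rewrite mem_enum.
Qed.

(** Without [e], the odd vertices of [Z] are the ends of [e], so a path in the rest joins them and
    [e] closes it. For a loop that path is empty. *)
Lemma even_has_cycle Z : even_set Z -> Z != set0 ->
  exists C, is_cycle ends C /\ C \subset Z.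
Proof.
move=> eZ /set0Pn[e eZ1].
have lF : links (Z :\ e) (ends e).1 (ends e).2.
  move=> w; rewrite -symdiff_subset ?sub1set // boundary_symdiff eZ boundary1.
  by rewrite (joins_incident _ (joins_ends e)).
have [vs [es [h lst uvs ues sF]]] := links_steps lF.
have ees : e \notin es by apply/negP=> /sF; rewrite !inE eqxx.
set u := (ends e).1 in h lst uvs lF *.
exists [set f in e :: es]; split; last first.
  apply/subsetP=> f; rewrite !inE => /orP[/eqP->//|/sF].
  by rewrite inE => /andP[].
(* The first edge is [e], so the vertex list starts where the path ends. *)
exists (last u vs), (belast u vs), e, es; split=> //.
- by rewrite size_belast (steps_size h).
- by move: uvs; rewrite lastI rcons_uniq.
- by rewrite /= ees ues.
- move=> [|i] lti; rewrite -lastI /=.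
    by rewrite lst joinsC joins_ends.
  have := steps_nth (last u vs) e h lti; congr joins.
  rewrite (_ : nth _ (u :: vs) i = nth (last u vs) (rcons (belast u vs) (last u vs)) i);
    last by rewrite -lastI.
  by rewrite nth_rcons size_belast (steps_size h) lti.
Qed.

End Boundary.

(** * Closed trails, and the equivalence of cycles and circuits *)

Section Tours.
Variables (V E : finType) (ends : E -> V * V).
Implicit Types (C Z : {set E}) (v : nat -> V) (e : nat -> E).

Definition seg e i j : {set E} := [set x in map e (index_iota i j)].

(** Indexing by numbers turns arcs and reversal into arithmetic; index [n] is the return to the
    start, so that arcs can end there. *)
Definition tour n v e C :=
  [/\ 0 < n, v n = v 0, forall i, i < n -> joins ends (e i) (v i) (v i.+1),
      forall i j, i < n -> j < n -> e i = e j -> i = j & C = seg e 0 n].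

Lemma segP e i j x : reflect (exists2 k, i <= k < j & x = e k) (x \in seg e i j).
Proof.
rewrite inE; apply: (iffP mapP) => [] [k hk ->]; exists k => //.
  by rewrite mem_index_iota in hk.
by rewrite mem_index_iota.
Qed.

Lemma is_cycle_simple_tour C : is_cycle ends C ->
  exists n v e, tour n v e C /\ (forall i j, i < n -> j < n -> v i = v j -> i = j).
Proof.
case=> v0 [vs [e0 [es [sz uv ue h ->]]]].
exists (size (e0 :: es)), (nth v0 (rcons (v0 :: vs) v0)), (nth e0 (e0 :: es)).
split.
  split=> //.
  - by rewrite /= -sz nth_rcons ltnn eqxx.
  - move=> i lti; have := h i lti.
    by rewrite (nth_rcons _ (v0 :: vs)) /= sz lti.
  - by move=> i j lti ltj /eqP; rewrite (nth_uniq e0 _ _ ue) // => /eqP.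
  - by rewrite /seg /index_iota subn0 -/(mkseq _ _) mkseq_nth.
move=> i j; rewrite /= -sz => lti ltj; rewrite -rcons_cons !nth_rcons /= lti ltj.
by move/eqP; rewrite (nth_uniq v0 _ _ uv) // => /eqP.
Qed.

Section Tour.
Variables (n : nat) (v : nat -> V) (e : nat -> E) (C : {set E}).
Hypothesis hC : tour n v e C.

Lemma tour_mem i : i < n -> e i \in C.
Proof. by case: hC => _ _ _ _ -> lti; apply/segP; exists i. Qed.

Lemma seg_sub i j : j <= n -> seg e i j \subset C.
Proof.
move=> jn; apply/subsetP=> x /segP[k /andP[_ kj] ->].
by apply: tour_mem; apply: leq_trans kj jn.
Qed.

Lemma card_seg i j : j <= n -> #|seg e i j| = j - i.
Proof.
case: hC => _ _ _ ie _ jn.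
rewrite cardsE (card_uniqP _) ?size_map ?size_iota //.
rewrite map_inj_in_uniq ?iota_uniq // => a b; rewrite !mem_index_iota.
move=> /andP[_ aj] /andP[_ bj]; apply: ie; exact: leq_trans jn.
Qed.

Lemma card_tour : #|C| = n.
Proof. by have := card_seg 0 (leqnn n); case: hC => _ _ _ _ <-; rewrite subn0. Qed.

Lemma segS i j : i <= j -> j < n -> seg e i j.+1 = seg e i j :+: [set e j].
Proof.
case: hC => _ _ _ ie _ ij jn; rewrite symdiff_set1.
  apply/setP=> x; rewrite in_setU1; apply/segP/idP.
    case=> k /andP[ik]; rewrite ltnS leq_eqVlt => /orP[/eqP->|kj] ->.
      by rewrite eqxx.
    by apply/orP; right; apply/segP; exists k; rewrite ?ik.
  case/predU1P=> [->|/segP[k /andP[ik kj] ->]].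
    by exists j; rewrite ?ij /=.
  by exists k; rewrite // ik ltnS ltnW.
apply/segP=> -[k /andP[_ kj] /ie]; lia.
Qed.

Lemma seg_links i j : i <= j <= n -> links ends (seg e i j) (v i) (v j).
Proof.
case/andP; elim: j => [|j IH].
  rewrite leqn0 => /eqP-> _ w; rewrite addbb.
  suff -> : seg e 0 0 = set0 by rewrite boundary0.
  by apply/setP=> x; rewrite !inE.
rewrite leq_eqVlt => /predU1P[->|ij] jn.
  move=> w; rewrite addbb; suff -> : seg e j.+1 j.+1 = set0 by rewrite boundary0.
  by apply/setP=> x; rewrite !inE /index_iota subnn.
rewrite segS //; apply: links_trans (IH ij (ltnW jn)) _.
by apply: joins_links; case: hC => _ _ /(_ _ jn).
Qed.

Lemma tour_even : even_set ends C.
Proof.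
case: hC => _ vn _ _ -> w; rewrite (seg_links (j := n)) ?leqnn //.
by rewrite vn addbb.
Qed.

(* Consecutive edges of a cycle are the only ones at their common vertex, so an
   even subset contains both or neither. *)
Lemma tour_circuit :
  (forall i j, i < n -> j < n -> v i = v j -> i = j) -> circuit ends C.
Proof.
move=> iv; case: (hC) => n0 vn je ie defC; split; last 2 first.
- exact: tour_even.
- move=> Z ZC Z0 eZ.
  have step i : i.+1 < n -> (e i \in Z) = (e i.+1 \in Z).
    move=> lti; have := eZ (v i.+1).
    rewrite /boundary (bigD1 (e i)) //= (bigD1 (e i.+1)) /=; last first.
      by apply/eqP=> /ie; lia.
    rewrite big1 => [|f /andP[fi fi']]; last first.
      case fZ: (f \in Z) => //=; have := subsetP ZC f fZ.
      rewrite defC => /segP[k /andP[_ kn] def_f].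
      rewrite def_f (joins_incident _ (je k kn)).
      have -> : (v k == v i.+1) = false.
        by apply/eqP=> /iv h; rewrite def_f h ?eqxx in fi'; lia.
      apply/eqP=> h; case: (ltnP k.+1 n) => kn'.
        by have := iv _ _ kn' lti h => -[ki]; rewrite def_f ki eqxx in fi.
      have kn1 : k.+1 = n by lia.
      rewrite kn1 vn in h; have := iv _ _ n0 lti h; lia.
    rewrite !(joins_incident _ (je _ _)) ?(ltnW lti) // eqxx.
    have -> : (v i == v i.+1) = false by apply/eqP=> /iv; lia.
    have -> : (v i.+2 == v i.+1) = false.
      apply/eqP=> h; case: (ltnP i.+2 n) => i2n.
        by have := iv _ _ i2n lti h; lia.
      have i2 : i.+2 = n by lia.
      by rewrite i2 vn in h; have := iv _ _ n0 lti h; lia.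
    by rewrite /= addbF !andbT; do 2!case: (_ \in Z).
  have all0 i : i < n -> (e i \in Z) = (e 0 \in Z).
    by elim: i => // i IH lti; rewrite -step // IH // ltnW.
  apply/eqP; rewrite eqEsubset ZC /=; apply/subsetP=> x.
  rewrite defC => /segP[k /andP[_ kn] ->]; rewrite all0 //.
  case/set0Pn: Z0 => y yZ; have := subsetP ZC y yZ.
  by rewrite defC => /segP[j /andP[_ jn] yj]; rewrite -(all0 j) // -yj.
- by apply/set0Pn; exists (e 0); apply: tour_mem.
Qed.

(** Fixes the start and exchanges the two halves, so that arguments about one side of the antipode
    serve for the other. *)
Lemma tour_rev : tour n (fun i => v (n - i)) (fun i => e (n - i.+1)) C.
Proof.
case: (hC) => n0 vn je ie defC; split=> //.
- by rewrite subnn subn0.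
- move=> i lti; rewrite joinsC.
  have -> : n - i = (n - i.+1).+1 by lia.
  by apply: je; lia.
- move=> i j lti ltj /ie; lia.
- rewrite defC; apply/setP=> x; apply/segP/segP=> -[k /andP[_ kn] ->].
    exists (n - k.+1); first lia.
    by congr e; lia.
  by exists (n - k.+1); first lia.
Qed.

End Tour.

Lemma is_cycle_tour C : is_cycle ends C -> exists n v e, tour n v e C.
Proof. by move=> /is_cycle_simple_tour[n [v [e [h _]]]]; exists n, v, e. Qed.

Lemma circuitP C : circuit ends C <-> is_cycle ends C.
Proof.
split=> [[C0 eC minC]|/is_cycle_simple_tour[n [v [e [h iv]]]]]; last first.
  exact: tour_circuit h iv.
have [D [cD DC]] := even_has_cycle eC C0.
have [n [v [e [h iv]]]] := is_cycle_simple_tour cD.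
by have [D0 eD _] := tour_circuit h iv; rewrite -(minC D).
Qed.

End Tours.

(** * Isometric cycles, and splitting of the others *)

Section Isometric.
Variables (V E : finType) (ends : E -> V * V).
Implicit Types (A B C D P Z : {set E}).

(* With [A] an arc of the cycle [D] and [P] a path between its ends, this says
   that [P] is at least as long as the shorter of the two arcs; allowing arbitrary
   [A] and [P] avoids speaking of vertices. *)
Definition isometric D := forall A P, A \subset D ->
  boundary ends P =1 boundary ends A -> minn #|A| #|D :\: A| <= #|P|.

Lemma even_setP C : reflect (even_set ends C) [forall v, ~~ boundary ends C v].
Proof.
by apply: (iffP forallP) => h v; [apply/negbTE; apply: h | rewrite h].
Qed.

(** A boolean form of being a cycle, which allows choosing a cycle of minimum size
    constructively. *)
Lemma circuit_minset C : circuit ends C <->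
  minset [pred Z : {set E} | (Z != set0) && [forall v, ~~ boundary ends Z v]] C.
Proof.
split=> [[C0 /even_setP eC minC]|/minsetP[/andP[C0 /even_setP eC] minC]].
  apply/minsetP; split=> [|Z /andP[Z0 /even_setP eZ] ZC]; first by rewrite /= C0.
  exact: minC.
by split=> // Z ZC Z0 /even_setP eZ; apply: minC; rewrite //= Z0.
Qed.

(* For a violation of isometry with [#|P|] minimal, [P :+: A] is a circuit. *)
Lemma isometric_or_split D : circuit ends D -> isometric D \/
  exists D1 D2, [/\ circuit ends D1, circuit ends D2, D = D1 :+: D2,
                    #|D1| < #|D| & #|D2| < #|D|].
Proof.
case=> D0 eD minD.
pose bad (X : {set E} * {set E}) := [&& X.1 \subset D,
  [forall v, boundary ends X.2 v == boundary ends X.1 v] &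
  #|X.2| < minn #|X.1| #|D :\: X.1|].
case: (pickP bad) => [X0 badX0|nobad]; last first.
  left=> A P AD PA; rewrite leqNgt; apply/negP=> lt.
  have /andP[] := nobad (A, P); split=> //; rewrite /= lt andbT.
  by apply/forallP=> v; rewrite PA.
right; case: (arg_minnP (fun X : {set E} * {set E} => #|X.2|) badX0).
move=> -[A P] badX minX {X0 badX0}.
have small A' P' : A' \subset D -> boundary ends P' =1 boundary ends A' ->
    #|P'| < #|P| -> minn #|A'| #|D :\: A'| <= #|P'|.
  move=> AD PA lt; rewrite leqNgt; apply/negP=> lt'.
  have /minX /= : bad (A', P').
    by apply/and3P; split=> //; apply/forallP=> v; rewrite PA.
  by rewrite leqNgt lt.
(* Stated for any [A'], since it is applied to [A] and to the complementary arc. *)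
have key A' : bad (A', P) -> circuit ends (P :+: A').
  case/and3P=> /= A'D /forallP/(_ _)/eqP PA' ltP.
  have dPA g : g \in P -> g \in D = false.
    move=> gP; apply/negP=> gD.
    have cP : #|P :+: [set g]| < #|P|.
      by rewrite symdiff_subset ?sub1set // [#|P|](cardsD1 g) gP.
    have := small (A' :+: [set g]) (P :+: [set g]).
    rewrite cP symdiff_sub ?sub1set // => /(_ isT _ isT).
    have -> : #|P :+: [set g]| = #|P|.-1.
      by rewrite symdiff_subset ?sub1set // [in RHS](cardsD1 g) gP.
    have PA v : boundary ends (P :+: [set g]) v = boundary ends (A' :+: [set g]) v.
      by rewrite !boundary_symdiff PA'.
    move/(_ PA).
    have : #|P| > 0 by apply/card_gt0P; exists g.
    have := card_symdiff A' [set g]; rewrite cards1.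
    have A'gD : A' :+: [set g] \subset D by apply: symdiff_sub; rewrite ?sub1set.
    have := cardsID A' D; have := cardsID (A' :+: [set g]) D.
    rewrite (setIidPr A'D) (setIidPr A'gD).
    have := subset_leq_card (subsetIr A' [set g]); rewrite cards1.
    lia.
  have [ltA ltB] : #|P| < #|A'| /\ #|P| < #|D :\: A'| by move: ltP; lia.
  split.
  - by apply/eqP=> /symdiff_eq0 PA; rewrite PA ltnn in ltA.
  - by move=> v; rewrite boundary_symdiff PA' addbb.
  move=> Z ZPA Z0 eZ; set A1 := Z :&: A'; set P1 := Z :&: P.
  have defZ : Z = P1 :+: A1.
    apply/setP=> z; rewrite in_symdiff !inE; case zZ: (z \in Z) => //=.
    by have := subsetP ZPA z zZ; rewrite in_symdiff => ->.
  have PA1 : boundary ends P1 =1 boundary ends A1.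
    move=> v; have := eZ v; rewrite {1}defZ boundary_symdiff.
    by do 2!case: boundary.
  have PA2 : boundary ends (P :\: P1) =1 boundary ends (A' :\: A1).
    by move=> v; rewrite -!symdiff_subset ?subsetIr // !boundary_symdiff PA1 PA'.
  have A1D : A1 \subset D := subset_trans (subsetIr _ _) A'D.
  have A2D : A' :\: A1 \subset D := subset_trans (subsetDl _ _) A'D.
  have A_empty B : B \subset A' -> even_set ends B -> B = set0.
    move=> BA eB; apply/eqP; apply/idPn=> B0.
    have BD := minD B (subset_trans BA A'D) B0 eB.
    have /eqP DA : D :\: A' == set0 by rewrite setD_eq0 -BD.
    by rewrite DA cards0 in ltB.
  have cP : #|P1| + #|P :\: P1| = #|P|.
    by rewrite -(cardsID P1 P) (setIidPr _) ?subsetIr.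
  have cA : #|A1| + #|A' :\: A1| = #|A'|.
    by rewrite -(cardsID A1 A') (setIidPr _) ?subsetIr.
  have bigD B : B \subset A' -> #|D :\: A'| <= #|D :\: B|.
    by move=> BA; apply: subset_leq_card; apply: setDS.
  case: (posnP #|P1|) => [/eqP|P1_gt0].
    rewrite cards_eq0 => /eqP P10; case/eqP: Z0.
    have A10 : A1 = set0.
      by apply: A_empty; rewrite ?subsetIr // => v; rewrite -PA1 P10 boundary0.
    by rewrite defZ P10 A10 symdiffAA.
  case: (posnP #|P :\: P1|) => [/eqP|P2_gt0].
    rewrite cards_eq0 => P20; have PP : P1 = P.
      by apply/eqP; rewrite eqEsubset subsetIr -setD_eq0.
    have A20 : A' :\: A1 = set0.
      apply: A_empty; rewrite ?subsetDl // => v.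
      by rewrite -PA2 (eqP P20) boundary0.
    have AA : A1 = A' by apply/eqP; rewrite eqEsubset subsetIr -setD_eq0 A20 eqxx.
    by rewrite defZ PP AA.
  (* Both parts of [P] are smaller than [P], so neither pair violates isometry. As [D] minus a part
     of [A'] has more edges than [P], each part of [A'] is at most as large as its part of [P],
     whence [#|A'| <= #|P|]. *)
  have := small _ _ A1D PA1; have := small _ _ A2D PA2.
  have := bigD _ (subsetIr Z A'); have := bigD _ (subsetDl A' A1).
  rewrite -/A1; lia.
have badB : bad (D :\: A, P).
  case/and3P: badX => /= AD /forallP PA ltP; apply/and3P; split=> /=.
  - exact: subsetDl.
  - by apply/forallP=> v; rewrite -symdiff_subset // boundary_symdiff eD (eqP (PA v)).
  - by rewrite setDDr setDv set0U (setIidPr AD) minnC.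
(* [P] closes up each arc and is shorter than the arc it replaces. *)
exists (P :+: A), (P :+: (D :\: A)); split; [exact: key | exact: key | | |].
- case/and3P: badX => /= AD _ _.
  rewrite -symdiff_subset // [P :+: A]symdiffC -symdiffA [P :+: (P :+: _)]symdiffA.
  by rewrite symdiffAA [set0 :+: _]symdiffC symdiff0 [D :+: A]symdiffC symdiffA symdiffAA
             [set0 :+: _]symdiffC symdiff0.
- case/and3P: badX => /= AD _; have := leq_card_symdiff P A.
  have := cardsID A D; rewrite (setIidPr AD); lia.
- case/and3P: badX => /= AD _; have := leq_card_symdiff P (D :\: A).
  have := cardsID A D; rewrite (setIidPr AD); lia.
Qed.

End Isometric.

(** * Root paths in breadth-first trees *)

Section Trees.
Variables (V E : finType) (ends : E -> V * V).
Implicit Types (P Q T Z : {set E}).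

(* [t v] is the edge set of the path from the root [x] to [v] in the breadth-first
   tree [T]; in the last clause [g] is the edge from [v] to its parent, and [g]
   lies on [t u] only if [v] is an ancestor of [u]. *)
Definition bfs_paths T (x : V) (t : V -> {set E}) :=
  [/\ forall v, t v \subset T, forall v, links ends (t v) x v,
      forall v Q, links ends Q x v -> #|t v| <= #|Q|,
      forall Z, Z \subset T -> even_set ends Z -> Z = set0 &
      forall v, v != x -> exists2 g, g \in t v &
        forall u, g \in t u -> t v \subset t u].

Lemma walk_cat F u es1 es2 v : is_walk ends F u (es1 ++ es2) v ->
  exists2 w, is_walk ends F u es1 w & is_walk ends F w es2 v.
Proof.
elim: es1 u => [|e es1 IH] u /=; first by exists u.
by case=> eF [w [j /IH[z h1 h2]]]; exists z => //; split=> //; exists w.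
Qed.

(** By acyclicity at most one subset of [T] links two given vertices, so the edges of a shortest
    tree walk determine [t v]. The edge [g] is the last one of such a walk. *)
Lemma bfs_tree_paths T x : bfs_tree ends T x -> exists t, bfs_paths T x t.
Proof.
case=> -[_ acyc] hbfs.
have tree0 Z : Z \subset T -> even_set ends Z -> Z = set0.
  move=> ZT eZ; apply/eqP; apply/idPn=> /(even_has_cycle eZ)[C [cC CZ]].
  exact: acyc cC (subset_trans CZ ZT).
have uniqT P Q u v : P \subset T -> Q \subset T ->
    links ends P u v -> links ends Q u v -> P = Q.
  move=> PT QT lP lQ; apply: symdiff_eq0; apply: tree0; first exact: symdiff_sub.
  by move=> w; rewrite boundary_symdiff lP lQ addbb.
have ex_t v : exists tv : {set E}, [/\ tv \subset T,
    links ends tv x v, forall Q, links ends Q x v -> #|tv| <= #|Q| &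
    exists2 es, is_walk ends T x es v & size es <= #|tv|].
  have [es [wes mines]] := hbfs v.
  have [P [PT _ sP lP]] := walk_links wes.
  have minQ Q : links ends Q x v -> size es <= #|Q|.
    by case/links_walk=> es' [wes']; apply: leq_trans (mines _ wes').
  exists P; split=> // [Q lQ|]; first exact: leq_trans sP (minQ Q lQ).
  by exists es => //; apply: minQ.
have [t ht] := fin_all_exists ex_t.
have {ht}[tT tl tmin twalk] := all_and4 ht.
have walk_t es v : is_walk ends T x es v -> {subset t v <= es} /\ #|t v| <= size es.
  case/walk_links=> P [PT Pes sP lP].
  by rewrite (uniqT (t v) P x v).
have tE e u v : e \in T -> joins ends e u v -> t v = t u :+: [set e].
  move=> eT j; apply: (uniqT _ _ x v) => //; last exact: links_trans (joins_links j).
  by apply: symdiff_sub; rewrite ?sub1set.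
exists t; split=> // v vx.
have [es wes ses] := twalk v.
case/lastP: es wes ses => [/= xv _|es g]; first by rewrite xv eqxx in vx.
rewrite -cats1 size_cat addn1 => /walk_cat[a wa [gT [w [j wv]]]] ses.
have {w wv}j : joins ends g a v by rewrite -wv.
exists g.
  have [_ sa] := walk_t _ _ wa; move: ses; rewrite (tE g a v) // => ses.
  rewrite in_symdiff inE eqxx addbT; apply/negP=> ga.
  move: ses; rewrite symdiff_subset ?sub1set // => ses.
  by have := cardsD1 g (t a); rewrite ga; lia.
move=> u gu; have [es' wes' ses'] := twalk u.
have [/(_ g gu) ges' _] := walk_t _ _ wes'.
case/splitPr: ges' wes' ses' => es1 es2 /walk_cat[c wc [_ [d [jd wd]]]].
rewrite size_cat /= => ses'.
have [_ sc] := walk_t _ _ wc; have [P [PT _ sP lP]] := walk_links wd.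
have td : t d = t c :+: [set g] by apply: tE.
have tu : t u = t d :+: P.
  apply: (uniqT _ _ x u) => //; first exact: symdiff_sub.
  exact: links_trans (tl d) lP.
(* The walk to [u] is shortest, so nothing cancels in [t d :+: P]. *)
have := card_symdiff (t d) P; have := card_symdiff (t c) [set g].
rewrite -tu -td cards1 => cd cu.
have dP0 : t d :&: P = set0 by apply/eqP; rewrite -cards_eq0; lia.
have [[ac vd]|[ad vc]] := joins_inj j jd.
  rewrite vd tu; apply/subsetP=> z zd; rewrite in_symdiff zd.
  by case zP: (z \in P) => //; have := in_set0 z; rewrite -dP0 inE zd zP.
(* Here [g] is crossed from [v] towards the root, so [d] is nearer to the root than [c] and the walk
   to [u] is not shortest. *)
have [_ sa] := walk_t _ _ wa; rewrite vc in ses; rewrite ad in sa.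
have := leq_card_symdiff (t d) P; rewrite -tu; lia.
Qed.

End Trees.

(** * Fundamental cycles and sums of two of them *)

Section FundamentalCycles.
Variables (V E : finType) (ends : E -> V * V) (T : {set E}) (x : V) (t : V -> {set E}).
Hypothesis hT : bfs_paths ends T x t.
Implicit Types (A B C P Z : {set E}).

(** The common initial part of the two root paths cancels. [locked] keeps the sum folded. *)
Definition fund e := locked ([set e] :+: t (ends e).1 :+: t (ends e).2).

Lemma bfs_sub v : t v \subset T. Proof. by have [-> ] := hT. Qed.

Lemma bfs_links v : links ends (t v) x v. Proof. by have [_ h] := hT. Qed.

Lemma bfs_min v P : links ends P x v -> #|t v| <= #|P|.
Proof. by have [_ _ h _ _] := hT; apply: h. Qed.

Lemma bfs_acyclic Z : Z \subset T -> even_set ends Z -> Z = set0.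
Proof. by have [_ _ _ h _] := hT; apply: h. Qed.

Lemma bfs_parent v : v != x -> exists2 g, g \in t v &
  forall u, g \in t u -> t v \subset t u.
Proof. by have [_ _ _ _ h] := hT; apply: h. Qed.

Lemma bfs_root : t x = set0.
Proof. by apply: bfs_acyclic; [exact: bfs_sub | move=> w; rewrite bfs_links addbb]. Qed.

Lemma bfs_path P u v : P \subset T -> links ends P u v -> t v = t u :+: P.
Proof.
move=> PT lP; apply: symdiff_eq0; apply: bfs_acyclic.
  by rewrite !symdiff_sub ?bfs_sub.
move=> w; rewrite !boundary_symdiff !bfs_links lP.
by case: (x == w); case: (u == w); case: (v == w).
Qed.

Lemma bfs_edge_parity e u v : e \in T -> joins ends e u v ->
  odd #|t v| = ~~ odd #|t u|.
Proof.
move=> eT /joins_links lP; rewrite (bfs_path _ lP) ?sub1set //.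
by rewrite odd_card_symdiff cards1 addbT.
Qed.

Lemma fundE e u v : joins ends e u v -> fund e = [set e] :+: t u :+: t v.
Proof.
rewrite /fund -lock; case/(joins_inj (joins_ends ends e)) => -[<- <-] //.
by rewrite -!symdiffA [t _ :+: t _]symdiffC.
Qed.

Lemma fund_even e : even_set ends (fund e).
Proof.
move=> w; rewrite (fundE (joins_ends ends e)) !boundary_symdiff !bfs_links.
rewrite boundary1 /incident.
by case: (x == w); case: (_ == w); case: (_ == w).
Qed.

Lemma fund_sub e : fund e \subset e |: T.
Proof.
have tT v : t v \subset e |: T := subset_trans (bfs_sub v) (subsetU1 e T).
by rewrite (fundE (joins_ends ends e)) !symdiff_sub ?tT // sub1set setU11.
Qed.

Lemma mem_fund e f : e \notin T -> f \notin T -> (f \in fund e) = (f == e).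
Proof.
move=> eT fT; have nt v : (f \in t v) = false.
  by apply: contraNF fT => /(subsetP (bfs_sub v)).
by rewrite (fundE (joins_ends ends e)) !in_symdiff !nt !addbF inE.
Qed.

(** In [Z :+: fund e] the edge [e] cancels, so this even set lies in [T] and vanishes. *)
Lemma fund_uniq e Z : even_set ends Z -> Z \subset e |: T -> e \in Z ->
  e \notin T -> Z = fund e.
Proof.
move=> eZ ZT eZ1 eT; apply: symdiff_eq0; apply: bfs_acyclic; last first.
  exact: even_symdiff eZ (fund_even e).
apply/subsetP=> f; rewrite in_symdiff.
have [-> | fe] := eqVneq f e; first by rewrite eZ1 mem_fund // eqxx.
move=> h; have : f \in e |: T.
  move: h; case fZ: (f \in Z); first by rewrite (subsetP ZT).
  by rewrite addFb => /(subsetP (fund_sub e)).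
by rewrite in_setU1 (negbTE fe).
Qed.

Lemma fund_circuit e : e \notin T -> circuit ends (fund e).
Proof.
move=> eT; split; [|exact: fund_even|].
  by apply/set0Pn; exists e; rewrite mem_fund.
move=> Z Zf Z0 eZ; apply: fund_uniq => //; first exact: subset_trans (fund_sub e).
apply: contraNT Z0 => neZ; apply/eqP; apply: bfs_acyclic => //.
apply/subsetP=> f fZ; have := subsetP (fund_sub e) f (subsetP Zf f fZ).
by rewrite in_setU1 => /predU1P[fe|//]; rewrite -fe fZ in neZ.
Qed.

Lemma fund_is_fund e : e \notin T -> fund_cycle ends T e (fund e).
Proof.
by move=> eT; split=> //; split; [apply/circuitP; exact: fund_circuit | exact: fund_sub].
Qed.

Lemma even_two_chords e f Z : even_set ends Z -> Z \subset e |: (f |: T) ->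
  e \in Z -> f \in Z -> e \notin T -> f \notin T -> e != f -> Z = fund e :+: fund f.
Proof.
move=> eZ ZT eZ1 fZ1 eT fT ef; apply: symdiff_eq0; apply: bfs_acyclic; last first.
  by apply: even_symdiff eZ (even_symdiff (fund_even e) (fund_even f)).
apply/subsetP=> z; apply: contraLR => zT.
rewrite !in_symdiff !mem_fund //.
have [->|ze] := eqVneq z e; first by rewrite eZ1 (negbTE ef).
have [->|zf] := eqVneq z f; first by rewrite fZ1.
rewrite !addbF; apply: contra zT => /(subsetP ZT).
by rewrite !in_setU1 (negbTE ze) (negbTE zf).
Qed.

(* A nonempty proper even subset of the sum would be [fund e] or [fund f]; both
   contain [g], which cancels in the sum. *)
Lemma fund_pair_circuit e f g : e \notin T -> f \notin T -> e != f ->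
  g \in fund e -> g \in fund f -> circuit ends (fund e :+: fund f).
Proof.
move=> eT fT ef ge gf; have fe : f != e by rewrite eq_sym.
have eS : e \in fund e :+: fund f.
  by rewrite in_symdiff !mem_fund // eqxx (negbTE ef).
split; [by apply/set0Pn; exists e | by apply: even_symdiff; exact: fund_even |].
move=> Z ZS Z0 eZ.
have gZ : g \in Z = false by apply/negP=> /(subsetP ZS); rewrite in_symdiff ge gf.
have ZT : Z \subset e |: (f |: T).
  apply: subset_trans ZS _; apply: symdiff_sub.
    by apply: subset_trans (fund_sub e) _; apply: setUS; exact: subsetUr.
  by apply: subset_trans (fund_sub f) _; exact: subsetUr.
have single a b : a \notin T -> Z \subset a |: (b |: T) -> a \in Z -> b \notin Z ->
    Z = fund a.
  move=> aT ZT' aZ bZ; apply: fund_uniq => //; apply/subsetP=> z zZ.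
  have := subsetP ZT' z zZ; rewrite !in_setU1.
  by have [zb|//] := eqVneq z b; rewrite -zb zZ in bZ.
case eZ1: (e \in Z); case fZ1: (f \in Z).
- exact: even_two_chords.
- by rewrite (single e f) ?fZ1 ?ge in gZ.
- by rewrite (single f e) ?eZ1 ?gf // setUCA in gZ.
- case/eqP: Z0; apply: bfs_acyclic => //; apply/subsetP=> z zZ.
  have := subsetP ZT z zZ; rewrite !in_setU1.
  by have [ze|_] := eqVneq z e; have [zf|_] := eqVneq z f;
    rewrite -?ze -?zf ?zZ in eZ1 fZ1 *.
Qed.

End FundamentalCycles.

(* [lia] case-splits on boolean atoms, hence the clearing of irrelevant ones. *)
Local Ltac nlia :=
  repeat match goal with
  | H : context [@in_mem] |- _ => clear H
  | H : context [@subset] |- _ => clear H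
  end; lia.

(** * Pairs of non-tree edges on an isometric cycle *)

Section AntipodalPair.
Variables (V E : finType) (ends : E -> V * V) (lam : E -> bool) (Tf : V -> {set E}).
Variables (x : V) (t : V -> {set E}).
Local Notation T := (Tf x).
Hypothesis hT : bfs_paths ends T x t.
Local Notation fund := (fund ends t).

(** With [n] the length of an isometric cycle, this contradicts all twosided cycles being longer
    than [n], or supplies a replacement in [in_C] for a shortest twosided cycle. *)
Definition short_twosided (n : nat) := exists Z,
  [/\ in_C ends Tf Z, is_cycle ends Z, twosided lam Z & #|Z| <= n].

Section Tour.
Variables (n : nat) (v : nat -> V) (e : nat -> E) (D : {set E}).
Hypothesis hD : tour ends n v e D.
Hypothesis vx : v 0 = x.

Lemma tour_joins i : i < n -> joins ends (e i) (v i) (v i.+1).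
Proof. by case: hD => _ _ h _ _; apply: h. Qed.

Lemma tour_end : v n = x.
Proof. by case: hD => _ -> _ _ _. Qed.

Lemma tour_inj i j : i < n -> j < n -> e i = e j -> i = j.
Proof. by case: hD => _ _ _ h _; apply: h. Qed.

Lemma mem_tour f : f \in D -> exists2 i, i < n & f = e i.
Proof. by case: hD => _ _ _ _ -> /segP[i]; exists i. Qed.

Lemma depth_le i : i <= n -> #|t (v i)| <= minn i (n - i).
Proof.
move=> lin; rewrite leq_min; apply/andP; split.
  rewrite -[leqRHS]subn0 -(card_seg hD 0 lin); apply: (bfs_min hT).
  by rewrite -vx; apply: (seg_links hD).
rewrite -(card_seg hD i (leqnn n)); apply: (bfs_min hT).
by rewrite -tour_end; apply/links_sym/(seg_links hD); rewrite lin leqnn.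
Qed.

Lemma fundE_tour i : i < n -> fund (e i) = [set e i] :+: t (v i) :+: t (v i.+1).
Proof. by move=> lti; apply: fundE; apply: tour_joins. Qed.

(** The bound is at most [n], with equality only at the antipode of the root: for the edge opposite
    it if [n] is odd, for the two edges at it if [n] is even. *)
Lemma card_fund_tour i : i < n ->
  #|fund (e i)| <= (minn i (n - i) + minn i.+1 (n - i.+1)).+1.
Proof.
move=> lti; rewrite fundE_tour //.
have := depth_le lti; have := depth_le (ltnW lti).
have := leq_card_symdiff ([set e i] :+: t (v i)) (t (v i.+1)).
have := leq_card_symdiff [set e i] (t (v i)); rewrite cards1; nlia.
Qed.

Lemma seg_path i j : i <= j <= n -> seg e i j \subset T ->
  t (v j) = t (v i) :+: seg e i j.
Proof. by move=> ijn sT; apply: (bfs_path hT) => //; apply: (seg_links hD). Qed.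

Lemma seg1 i : seg e i i.+1 = [set e i].
Proof.
apply/setP=> f; rewrite in_set1; apply/segP/eqP=> [[k ki ->]|->].
  by congr e; nlia.
by exists i; rewrite ?leqnn /=.
Qed.

Lemma seg_cat i j k : i <= j <= k -> k <= n -> seg e i j :+: seg e j k = seg e i k.
Proof.
case/andP=> ij; elim: k => [|k IH].
  rewrite leqn0 => /eqP j0 _; suff -> : seg e j 0 = set0 by rewrite symdiff0 j0.
  by apply/setP=> f; rewrite !inE j0.
rewrite leq_eqVlt => /predU1P[->|jk] kn.
  suff -> : seg e k.+1 k.+1 = set0 by rewrite symdiff0.
  by apply/setP=> f; rewrite !inE /index_iota subnn.
rewrite !(segS hD) ?symdiffA ?IH //; [exact: ltnW| exact: leq_trans ij _].
Qed.

(** The tree arc between the two edges makes the inner root paths cancel. What remains is the arc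
    from [v i] to [v j.+1] and two root paths of at most [i] and [n - j.+1] edges. *)
Lemma fund_pair_card i j : i < j < n -> seg e i.+1 j \subset T ->
  #|fund (e i) :+: fund (e j)| <= n.
Proof.
case/andP=> ij jn sT; have lin := ltn_trans ij jn.
have -> : fund (e i) :+: fund (e j) = seg e i j.+1 :+: t (v i) :+: t (v j.+1).
  rewrite !fundE_tour // (seg_path _ sT) ?ij ?(ltnW jn) //.
  rewrite -(@seg_cat i i.+1 j.+1) ?leqnSn ?ltnS ?(ltnW ij) // seg1 (segS hD) //.
  apply/setP=> f; rewrite !in_symdiff.
  by do !case: (f \in _).
have := depth_le jn; have := depth_le (ltnW lin).
have := leq_card_symdiff (seg e i j.+1 :+: t (v i)) (t (v j.+1)).
have := leq_card_symdiff (seg e i j.+1) (t (v i)); rewrite (card_seg hD) //; nlia.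
Qed.

(** If both fundamental cycles are onesided, their sum is twosided; the common edge [g] makes it a
    cycle. *)
Lemma short_pair i j g : i < j < n -> e i \notin T -> e j \notin T ->
  seg e i.+1 j \subset T -> g \in fund (e i) -> g \in fund (e j) -> short_twosided n.
Proof.
case/andP=> ij jn eiT ejT sT gi gj; have lin := ltn_trans ij jn.
have C1 k : e k \notin T -> in_C1 ends Tf (fund (e k)).
  by move=> ekT; exists x, (e k); exact: fund_is_fund hT _ _.
have cyc k : e k \notin T -> is_cycle ends (fund (e k)).
  by move=> ekT; apply/circuitP; apply: fund_circuit hT _ _.
have one k : k < n -> e k \notin T -> twosided lam (fund (e k)) -> short_twosided n.
  move=> kn ekT tw; exists (fund (e k)); split; [left; exact: C1|exact: cyc|by []|].
  by have := card_fund_tour kn; nlia.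
case twi: (twosided lam (fund (e i))); first exact: one twi.
case twj: (twosided lam (fund (e j))); first exact: one twj.
have cyc2 : is_cycle ends (fund (e i) :+: fund (e j)).
  apply/circuitP; apply: (fund_pair_circuit hT) gi gj => //.
  by apply/eqP=> /tour_inj; nlia.
exists (fund (e i) :+: fund (e j)); split=> //.
- right; split=> //; exists (fund (e i)), (fund (e j)).
  by split; [exact: C1|split; [exact: C1|]].
- by rewrite twosided_symdiff twi twj.
- by apply: fund_pair_card; rewrite ?ij.
Qed.

Lemma last_nontree k i : i < k -> e i \notin T ->
  exists j, [/\ i <= j < k, e j \notin T & seg e j.+1 k \subset T].
Proof.
move=> ik eiT; have exP : exists j, (j < k) && (e j \notin T) by exists i; rewrite ik.
have ub j : (j < k) && (e j \notin T) -> j <= k by case/andP=> /ltnW.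
case: (ex_maxnP exP ub) => j /andP[jk ejT] maxj; exists j; split=> //.
  by rewrite jk maxj ?ik.
apply/subsetP=> f /segP[l /andP[jl lk] ->]; apply: contraLR jl => elT.
by rewrite -leqNgt maxj ?lk.
Qed.

Lemma first_nontree k i : k <= i -> e i \notin T ->
  exists j, [/\ k <= j <= i, e j \notin T & seg e k j \subset T].
Proof.
move=> ki eiT; have exP : exists j, (k <= j) && (e j \notin T) by exists i; rewrite ki.
case: (ex_minnP exP) => j /andP[kj ejT] minj; exists j; split=> //.
  by rewrite kj minj ?ki.
apply/subsetP=> f /segP[l /andP[kl lj] ->]; apply: contraLR lj => elT.
by rewrite -leqNgt minj ?kl.
Qed.

Hypothesis isoD : isometric ends D.

Lemma gap i j P : i <= j <= n -> links ends P (v i) (v j) ->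
  minn (j - i) (n - (j - i)) <= #|P|.
Proof.
case/andP=> ij jn lP; have := isoD (seg_sub hD i jn).
move=> /(_ P); rewrite (card_seg hD) //.
have := cardsID (seg e i j) D; rewrite (setIidPr (seg_sub hD i jn)).
rewrite (card_seg hD) // (card_tour hD) => cD h.
have : minn (j - i) #|D :\: seg e i j| <= #|P|.
  by apply: h => w; rewrite lP (seg_links hD) ?ij.
nlia.
Qed.

Lemma depth i : i <= n -> #|t (v i)| = minn i (n - i).
Proof.
move=> lin; apply/eqP; rewrite eqn_leq depth_le //=.
have := @gap 0 i (t (v i)); rewrite subn0; apply; rewrite ?lin // vx.
exact: bfs_links hT _.
Qed.

Lemma links_bfs u w : links ends (t u :+: t w) u w.
Proof. exact: links_trans (links_sym (bfs_links hT u)) (bfs_links hT w). Qed.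

(** Between a vertex and its ancestor the tree path has as many edges as their depths differ; the
    two truncated differences add up to the absolute one. *)
Lemma gap_anc i j : i <= j <= n ->
  t (v i) \subset t (v j) \/ t (v j) \subset t (v i) ->
  minn (j - i) (n - (j - i)) <= (#|t (v i)| - #|t (v j)|) + (#|t (v j)| - #|t (v i)|).
Proof.
move=> ijn sub; have := gap ijn (links_bfs (v i) (v j)).
have := card_symdiff (t (v i)) (t (v j)).
by case: sub => [/setIidPl|/setIidPr] ->; nlia.
Qed.

Lemma tour_parent i : 0 < i < n -> exists2 g, g \in t (v i) &
  forall u, g \in t u -> t (v i) \subset t u.
Proof.
case/andP=> i0 lin; apply: (bfs_parent hT); apply/eqP=> vix.
by have := depth (ltnW lin); rewrite vix (bfs_root hT) cards0; nlia.
Qed.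

(** Within the first half, depth grows by one per edge, so adding the tree arc to [t (v i)] cancels
    nothing. *)
Lemma descend i j : i <= j <= n -> j.*2 <= n -> seg e i j \subset T ->
  t (v i) \subset t (v j).
Proof.
case/andP=> ij jn j2 sT; have := card_symdiff (t (v i)) (seg e i j).
rewrite -seg_path ?ij // (card_seg hD) // !depth ?(leq_trans ij) // => c.
apply/setIidPl/eqP; rewrite eqEcard subsetIl /=.
have := subset_leq_card (subsetIl (t (v i)) (seg e i j)).
have : t (v i) :&: seg e i j = set0 by apply/eqP; rewrite -cards_eq0; nlia.
move=> dis _; suff -> : t (v i) :&: t (v j) = t (v i) by [].
rewrite (seg_path _ sT) ?ij //; apply/setP=> f; rewrite inE in_symdiff.
have := in_set0 f; rewrite -dis inE; case: (f \in t _) => //= ->.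
by [].
Qed.

Lemma ascend i j : i <= j <= n -> n <= i.*2 -> seg e i j \subset T ->
  t (v j) \subset t (v i).
Proof.
case/andP=> ij jn j2 sT; have lin := leq_trans ij jn.
have := card_symdiff (t (v j)) (seg e i j).
have def_ti : t (v i) = t (v j) :+: seg e i j by rewrite (seg_path _ sT) ?ij // symdiffK.
rewrite -def_ti (card_seg hD) // !depth // => c.
have dis : t (v j) :&: seg e i j = set0 by apply/eqP; rewrite -cards_eq0; nlia.
apply/subsetP=> f fj; rewrite def_ti in_symdiff fj.
by have := in_set0 f; rewrite -dis inE fj /= => ->.
Qed.

Lemma mem_fund_tour i g : i < n -> e i \notin T -> g \in T ->
  (g \in fund (e i)) = (g \in t (v i)) (+) (g \in t (v i.+1)).
Proof.
move=> lti eiT gT; rewrite fundE_tour // !in_symdiff inE.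
by have [ge|//] := eqVneq g (e i); rewrite -ge gT in eiT.
Qed.

Lemma not_anc i j g : (forall u, g \in t u -> t (v i) \subset t u) ->
  #|t (v j)| < #|t (v i)| -> g \in t (v j) = false.
Proof. by move=> anc lt; apply/negP=> /anc/subset_leq_card; rewrite leqNgt lt. Qed.

(** The shared edge [g] is the parent edge of [v j.+1], the deeper end of the last non-tree edge
    before [e m]. *)
Lemma odd_below m i : n = m.*2.+1 -> i < m -> e i \notin T -> e m \notin T ->
  short_twosided n.
Proof.
move=> nm im0 eiT0 emT; have [j [/andP[ij jm] ejT sT]] := last_nontree im0 eiT0.
have [|g gj anc] := @tour_parent j.+1; first nlia.
have gT : g \in T := subsetP (bfs_sub hT _) g gj.
apply: (@short_pair j m g) => //; first nlia.
  rewrite mem_fund_tour ?gj //; last nlia.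
  by rewrite (not_anc anc) // !depth; nlia.
have sub : t (v j.+1) \subset t (v m) by apply: descend; rewrite // ; nlia.
rewrite mem_fund_tour ?(subsetP sub) //; last nlia.
suff -> : g \in t (v m.+1) = false by [].
apply/negP=> /anc anc_m.
(* The depths are [j.+1] and [m], but the distance along the cycle is [m - j]. *)
have := @gap_anc j.+1 m.+1; rewrite !depth; [|nlia..].
by move=> /(_ _ (or_introl anc_m)); nlia.
Qed.

(** If the other edge at the antipode is outside the tree too, the two share the antipode's parent
    edge. Otherwise that other edge is itself the parent edge, and the next non-tree edge is sought
    on the side where [e i] lies. *)
Lemma even_near m i : n = m.*2 -> 0 < m -> i < n -> i != m.-1 ->
  e i \notin T -> e m.-1 \notin T -> short_twosided n.
Proof.
(* From here on [n = m.+1.*2], the antipode is [v m.+1], and its edges are [e m] and [e m.+1]. *)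
case: m => // m nm _ lin im eiT emT; rewrite /= in im emT.
have m1n : m.+1 < n by nlia.
have [|g0 g0m anc0] := @tour_parent m.+1; first nlia.
have g0T : g0 \in T := subsetP (bfs_sub hT _) g0 g0m.
case em1T: (e m.+1 \in T); last first.
  apply: (@short_pair m m.+1 g0); rewrite ?em1T //; first nlia.
  - by apply/subsetP=> f /segP[k kmm _]; nlia.
  - by rewrite mem_fund_tour ?g0m ?(not_anc anc0) // ?depth; nlia.
  - by rewrite mem_fund_tour ?g0m ?(not_anc anc0) // ?depth ?em1T; nlia.
have t_m1 : t (v m.+1) = t (v m.+2) :+: [set e m.+1].
  have s1 : seg e m.+1 m.+2 \subset T by rewrite seg1 sub1set.
  by rewrite (seg_path _ s1) ?seg1 ?symdiffK //; nlia.
have g0E : g0 = e m.+1.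
  move: g0m; rewrite t_m1 in_symdiff (not_anc anc0) ?inE => [/eqP //|].
  by rewrite !depth; nlia.
have [lt_im|lt_mi] : i < m \/ m.+1 < i.
  have : i != m.+1 by apply/eqP=> im1; rewrite im1 em1T in eiT.
  by move: im; nlia.
- have [j [/andP[ij jm] ejT sT]] := last_nontree lt_im eiT.
  have [|g gj anc] := @tour_parent j.+1; first nlia.
  have gT : g \in T := subsetP (bfs_sub hT _) g gj.
  have sub : t (v j.+1) \subset t (v m) by apply: descend; rewrite // ; nlia.
  apply: (@short_pair j m g) => //; first nlia.
    rewrite mem_fund_tour ?gj //; last nlia.
    by rewrite (not_anc anc) // !depth; nlia.
  rewrite mem_fund_tour ?(subsetP sub) //; last nlia.
  suff -> : g \in t (v m.+1) = false by [].
  apply/negP=> /anc anc_m.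
  (* An ancestor of the antipode other than itself is an ancestor of its parent [v m.+2], which is
     too far away along the cycle. *)
  have anc_m2 : t (v j.+1) \subset t (v m.+2).
    apply/subsetP=> f fj; have := subsetP anc_m f fj.
    rewrite t_m1 in_symdiff inE; case: eqP => [fe|_]; last by rewrite addbF.
    have : g0 \in t (v j.+1) = false by rewrite (not_anc anc0) // !depth; nlia.
    by rewrite g0E -fe fj.
  have := @gap_anc j.+1 m.+2; rewrite !depth; [|nlia..].
  by move=> /(_ _ (or_introl anc_m2)); nlia.
have [j [/andP[mj ji] ejT sT]] := first_nontree (ltnW lt_mi) eiT.
have mj' : m.+1 < j.
  by rewrite ltn_neqAle mj andbT; apply/eqP=> mj'; rewrite -mj' em1T in ejT.
have [|g gj anc] := @tour_parent j; first nlia.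
have gT : g \in T := subsetP (bfs_sub hT _) g gj.
have sub : t (v j) \subset t (v m.+1) by apply: ascend; rewrite // ; nlia.
apply: (@short_pair m j g) => //; first nlia.
  rewrite mem_fund_tour ?(subsetP sub _ gj) //; last nlia.
  suff -> : g \in t (v m) = false by [].
  apply/negP=> /anc anc_m.
  have := @gap_anc m j; rewrite !depth; [|nlia..].
  by move=> /(_ _ (or_intror anc_m)); nlia.
rewrite mem_fund_tour ?gj //; last nlia.
by rewrite (not_anc anc) // !depth; nlia.
Qed.

(** Both ends of [e m] have depth [m], while tree edges change the parity of the depth. *)
Lemma odd_antipode m : n = m.*2.+1 -> e m \notin T.
Proof.
move=> nm; apply/negP=> emT.
have := bfs_edge_parity hT emT (tour_joins _).
rewrite !depth; [|nlia..].
have -> : minn m (n - m) = m by nlia.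
have -> : minn m.+1 (n - m.+1) = m by nlia.
by move=> /(_ ltac:(nlia)); case: odd.
Qed.

(** Both neighbours of the antipode are nearer to the root, so a tree edge to either would be its
    unique parent edge. *)
Lemma even_antipode m : n = m.*2 -> 0 < m -> e m.-1 \notin T \/ e m \notin T.
Proof.
case: m => // m nm _ /=.
have [|g gm anc] := @tour_parent m.+1; first nlia.
case emT: (e m \in T); last by left.
case em1T: (e m.+1 \in T); last by right.
have s0 : seg e m m.+1 \subset T by rewrite seg1 sub1set.
have s1 : seg e m.+1 m.+2 \subset T by rewrite seg1 sub1set.
have g0 : g = e m.
  move: gm; rewrite (seg_path _ s0) ?seg1 ?in_symdiff ?(not_anc anc) ?inE;
    [|rewrite ?depth; nlia..].
  by move/eqP.
have : g \in t (v m.+2) = false by rewrite (not_anc anc) // !depth; nlia.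
rewrite (seg_path _ s1) ?seg1 ?in_symdiff ?gm ?inE; last nlia.
by move/negbFE/eqP; rewrite g0 => /tour_inj; nlia.
Qed.

Lemma only_nontree i : is_cycle ends D -> i < n -> e i \notin T ->
  (forall j, j < n -> e j \notin T -> j = i) -> fund_cycle ends T (e i) D.
Proof.
move=> cD lin eiT onlyi; split=> //; split=> //.
apply/subsetP=> f /mem_tour[j jn ->]; rewrite in_setU1.
by case ejT: (e j \in T); rewrite ?orbT // (onlyi j) ?ejT // eqxx.
Qed.

End Tour.

End AntipodalPair.

(** * The three claims about shortest cycles *)

Section Main.
Variables (V E : finType) (ends : E -> V * V) (Tf : V -> {set E}).
Hypothesis hbfs : forall x, bfs_tree ends (Tf x) x.
Implicit Types (C D Z : {set E}).

Lemma isometric_C1_or_short lam D : is_cycle ends D -> isometric ends D ->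
  in_C1 ends Tf D \/ short_twosided ends lam Tf #|D|.
Proof.
move=> cD isoD; have [n [v [e hD]]] := is_cycle_tour cD.
have [t hT] := bfs_tree_paths (hbfs (v 0)).
rewrite (card_tour hD); set T := Tf (v 0) in hT *.
have hR := tour_rev hD; have vR : v (n - 0) = v 0 by rewrite subn0 (tour_end hD erefl).
have close i : i < n -> e i \notin T ->
    (forall j, j < n -> e j \notin T -> j <> i -> short_twosided ends lam Tf n) ->
    in_C1 ends Tf D \/ short_twosided ends lam Tf n.
  move=> lin eiT other.
  case: (pickP [pred j : 'I_n | (e j \notin T) && (val j != i)]) => [j|none].
    by case/andP=> ejT /eqP ji; right; apply: other ejT ji.
  left; exists (v 0), (e i); apply: (only_nontree hD) => // j jn ejT.
  have := none (Ordinal jn); rewrite /= ejT /=.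
  by move/negbFE/eqP.
have n0 : 0 < n by case: hD.
have [nodd|neven] : n = n./2.*2.+1 \/ n = n./2.*2.
  by have := odd_double_half n; case: odd => /= <-; [left|right];
    rewrite ?add1n ?add0n; lia.
  set m := n./2 in nodd *.
  have emT : e m \notin T := odd_antipode hT hD erefl isoD nodd.
  apply: (close m) => //; first lia.
  move=> j jn ejT jm; have [jm'|mj] : j < m \/ m < j by lia.
    exact: (odd_below lam hT hD erefl isoD nodd jm' ejT emT).
  (* Edges beyond the middle are treated on the reversed tour, where [e j] has index [n - j.+1]. *)
  have eR : e (n - (n - j.+1).+1) \notin T by rewrite (_ : n - (n - j.+1).+1 = j) //; lia.
  have emR : e (n - m.+1) \notin T by rewrite (_ : n - m.+1 = m) //; lia.
  by apply: (odd_below lam hT hR vR isoD nodd _ eR emR); lia.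
set m := n./2 in neven *; have m0 : 0 < m by lia.
have [em|em] := even_antipode hT hD erefl isoD neven m0.
  apply: (close m.-1) => //; first lia.
  move=> j jn ejT /eqP jm.
  exact: (even_near lam hT hD erefl isoD neven m0 jn jm ejT em).
apply: (close m) => //; first lia.
move=> j jn ejT jm.
have eR : e (n - (n - j.+1).+1) \notin T by rewrite (_ : n - (n - j.+1).+1 = j) //; lia.
have emR : e (n - m.-1.+1) \notin T by rewrite (_ : n - m.-1.+1 = m) //; lia.
by apply: (even_near lam hT hR vR isoD neven m0 _ _ eR emR); lia.
Qed.

Lemma isometric_or_C lam C : is_cycle ends C -> twosided lam C ->
  (forall D, is_cycle ends D -> twosided lam D -> #|C| <= #|D|) ->
  isometric ends C \/ in_C ends Tf C.
Proof.
move=> cC twC minC.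
have onesided D : is_cycle ends D -> #|D| < #|C| -> twosided lam D = false.
  by move=> cD ltD; apply: contraTF ltD => twD; rewrite -leqNgt minC.
have C1 D : is_cycle ends D -> #|D| < #|C| -> in_C1 ends Tf D.
  move=> cD ltD; have isoD : isometric ends D.
    (* Splitting [D] would make it a sum of two onesided cycles, hence twosided. *)
    have /isometric_or_split[//|] := (circuitP ends D).2 cD.
    case=> D1 [D2 [/circuitP c1 /circuitP c2 defD lt1 lt2]].
    have := onesided _ cD ltD; rewrite defD twosided_symdiff.
    by rewrite !onesided // ?(ltn_trans lt1) ?(ltn_trans lt2).
  have [//|[Z [_ cZ twZ ltZ]]] := isometric_C1_or_short lam cD isoD.
  by rewrite onesided // (leq_ltn_trans ltZ) in twZ.
have /isometric_or_split[|] := (circuitP ends C).2 cC; first by left.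
case=> D1 [D2 [/circuitP c1 /circuitP c2 defC lt1 lt2]].
by right; right; split=> //; exists D1, D2; split; [|split]; rewrite // ; apply: C1.
Qed.

Lemma min_cycle (p : pred {set E}) : (exists C, is_cycle ends C /\ p C) ->
  exists C, [/\ is_cycle ends C, p C &
    forall D, is_cycle ends D -> p D -> #|C| <= #|D|].
Proof.
pose circ := minset [pred Z | (Z != set0) && [forall v, ~~ boundary ends Z v]].
have circE C : is_cycle ends C <-> circ C.
  by rewrite -circuitP circuit_minset.
case=> C0 [/circE c0 p0]; have pc0 : circ C0 && p C0 by rewrite c0.
case: (@arg_minnP _ C0 [pred C | circ C && p C] (fun C : {set E} => #|C|) pc0).
move=> C /andP[cC pC] minC.
exists C; split=> //; first exact/circE.
by move=> D /circE cD pD; apply: minC; rewrite inE cD.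
Qed.

Lemma shortest_twosided_in_C lam : (exists C, is_cycle ends C /\ twosided lam C) ->
  exists C, in_C ends Tf C /\ is_cycle ends C /\ twosided lam C /\
    forall D, is_cycle ends D -> twosided lam D -> #|C| <= #|D|.
Proof.
move=> /min_cycle[C [cC twC minC]].
have [isoC|inC] := isometric_or_C cC twC minC; last by exists C.
have [C1|[Z [inZ cZ twZ leZ]]] := isometric_C1_or_short lam cC isoC.
  by exists C; split; [left|].
exists Z; split=> //; split=> //; split=> // D cD twD.
exact: leq_trans leZ (minC D cD twD).
Qed.

Lemma twosided_even C : twosided (fun=> true) C = ~~ odd #|C|.
Proof.
by rewrite /twosided; congr (~~ odd #|pred_of_set _|); apply/setP=> f; rewrite inE andbT.
Qed.

(** A replacement does not suffice here. On an isometric even cycle the ends of an edge have depths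
    of opposite parity, so each non-tree edge has an even fundamental cycle. By minimality its
    length is at least [n], which leaves only the two edges at the antipode. *)
Lemma shortest_even_in_C C : is_cycle ends C -> ~~ odd #|C| ->
  (forall D, is_cycle ends D -> ~~ odd #|D| -> #|C| <= #|D|) -> in_C ends Tf C.
Proof.
move=> cC evC minC.
have [||isoC|//] := @isometric_or_C (fun=> true) C cC.
- by rewrite twosided_even.
- by move=> D cD; rewrite twosided_even; apply: minC.
have [n [v [e hC]]] := is_cycle_tour cC.
have [t hT] := bfs_tree_paths (hbfs (v 0)).
move: evC minC; rewrite (card_tour hC) => evn minC; set T := Tf (v 0) in hT.
have n0 : 0 < n by case: hC.
have [m nm] : exists m, n = m.+1.*2.
  by exists n./2.-1; have := odd_double_half n; rewrite (negbTE evn); lia.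
have nontree i : i < n -> e i \notin T -> i = m \/ i = m.+1.
  move=> lin eiT; have cF := fund_is_fund hT eiT.
  have ev : ~~ odd #|fund ends t (e i)|.
    rewrite (fundE_tour t hC lin) !odd_card_symdiff cards1.
    rewrite !(depth hT hC erefl isoC) //; last exact: ltnW.
    rewrite -addbA -oddD; case: (ltnP i m.+1) => im; last first.
      have -> : minn i (n - i) + minn i.+1 (n - i.+1) = (n - i.+1).*2.+1 by lia.
      by rewrite /= odd_double.
    have -> : minn i (n - i) + minn i.+1 (n - i.+1) = i.*2.+1 by lia.
    by rewrite /= odd_double.
  have := minC _ cF.2.1 ev; have := card_fund_tour hT hC erefl lin; lia.
have C1 i : i < n -> e i \notin T -> in_C1 ends Tf (fund ends t (e i)).
  by move=> lin eiT; exists (v 0), (e i); apply: fund_is_fund hT _ _.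
have mn : m < n by lia.
have m1n : m.+1 < n by lia.
(* With no edge outside [T], [C] would be empty; with one it is a fundamental cycle, with two the
   sum of two. *)
case emT: (e m \in T); case em1T: (e m.+1 \in T).
- have C0 : C = set0.
    apply: (bfs_acyclic hT); last exact: tour_even hC.
    apply/subsetP=> f /(mem_tour hC)[i lin ->]; apply/negPn/negP=> eiT.
    by have [im|im] := nontree i lin eiT; rewrite im ?emT ?em1T in eiT.
  by have := card_tour hC; rewrite C0 cards0; lia.
- left; exists (v 0), (e m.+1); apply: (only_nontree hC) => //; first by rewrite em1T.
  by move=> j jn ejT; have [jm|//] := nontree j jn ejT; rewrite jm emT in ejT.
- left; exists (v 0), (e m); apply: (only_nontree hC) => //; first by rewrite emT.
  by move=> j jn ejT; have [//|jm] := nontree j jn ejT; rewrite jm em1T in ejT.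
right; split=> //; exists (fund ends t (e m)), (fund ends t (e m.+1)).
split; [by apply: C1; rewrite ?emT | split; [by apply: C1; rewrite ?em1T |]].
apply: (even_two_chords hT (tour_even hC)); rewrite ?emT ?em1T //.
- apply/subsetP=> f /(mem_tour hC)[i lin ->]; rewrite !in_setU1.
  case eiT: (e i \in T); first by rewrite !orbT.
  by have [|->|->] := nontree i lin; rewrite ?eiT ?eqxx ?orbT.
- exact: tour_mem hC _ _.
- exact: tour_mem hC _ _.
- by apply/eqP=> /(tour_inj hC mn m1n); lia.
Qed.

(** Splitting would give a shorter cycle, so [C] is isometric. Any edge other than the one opposite
    the antipode would, if outside the tree, have too short a fundamental cycle. *)
Lemma odd_girth_in_C1 C : is_cycle ends C -> odd #|C| ->
  (forall D, is_cycle ends D -> #|C| <= #|D|) -> in_C1 ends Tf C.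
Proof.
move=> cC oddC minC; have isoC : isometric ends C.
  have /isometric_or_split[//|] := (circuitP ends C).2 cC.
  by case=> D1 [D2 [/circuitP c1 _ _ lt1 _]]; have := minC D1 c1; rewrite leqNgt lt1.
have [n [v [e hC]]] := is_cycle_tour cC.
have [t hT] := bfs_tree_paths (hbfs (v 0)).
move: oddC minC; rewrite (card_tour hC) => oddn minC.
have nm : n = n./2.*2.+1 by have := odd_double_half n; rewrite oddn; lia.
set m := n./2 in nm; have emT := odd_antipode hT hC erefl isoC nm.
exists (v 0), (e m); apply: (only_nontree hC) => //; first lia.
move=> j jn ejT; have := minC _ (fund_is_fund hT ejT).2.1.
have := card_fund_tour hT hC erefl jn; lia.
Qed.

End Main.

Theorem theoremA (V E : finType) (ends : E -> V * V) (lam : E -> bool)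
  (Tf : V -> {set E}) :
  connected_graph ends ->
  (forall x, bfs_tree ends (Tf x) x) ->
  (* (a) *)
  ((exists C, is_cycle ends C /\ twosided lam C) ->
     exists C, in_C ends Tf C /\ is_cycle ends C /\ twosided lam C /\
       forall D, is_cycle ends D -> twosided lam D -> #|C| <= #|D|) /\
  (* (b) *)
  (forall C, is_cycle ends C -> ~~ odd #|C| ->
     (forall D, is_cycle ends D -> ~~ odd #|D| -> #|C| <= #|D|) ->
     in_C ends Tf C) /\
  (* (c) *)
  ((exists C0, is_cycle ends C0 /\ odd #|C0| /\
       forall D, is_cycle ends D -> #|C0| <= #|D|) ->
     forall C, is_cycle ends C -> odd #|C| ->
       (forall D, is_cycle ends D -> odd #|D| -> #|C| <= #|D|) ->
       in_C1 ends Tf C).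
Proof.
move=> _ hbfs; split; first exact: shortest_twosided_in_C.
split=> [|[C0 [c0 [odd0 min0]]] C cC oddC minC]; first exact: shortest_even_in_C.
(* As [C0] is odd and of girth length, a shortest odd cycle is a shortest cycle. *)
apply: odd_girth_in_C1 => // D cD.
exact: leq_trans (minC C0 c0 odd0) (min0 D cD).
Qed.
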